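(* Let $l\ge 1$, let $p_1>p_2>\cdots>p_l\ge 1$ be integers, and let $s_1,\ldots,s_l$ be integers with $s_i\ge 3$ for every $i=1,\ldots,l$. Then the complete multipartite graph with $s_1$ parts of size $p_1$, $s_2$ parts of size $p_2$, $\ldots$, $s_l$ parts of size $p_l$, i.e. $K_{p_1,\ldots,p_1,\ldots,p_l,\ldots,p_l}$ (with $p_i$ repeated $s_i$ times), is $S$-determined.
   Context: All graphs are finite and simple. For a graph $G$, the Seidel matrix is $S(G)=J-I-2A(G)$, where $A(G)$ is the adjacency matrix, $J$ the all-ones matrix and $I$ the identity; its eigenvalue multiset is the Seidel spectrum of $G$. For a partition $V(G)=U\cup W$, Seidel switching with respect to $U$ deletes all edges between $U$ and $W$ and adds an edge between $u\in U$, $w\in W$ whenever $uw$ was not an edge. Two graphs are switching equivalent if one is obtained from the other by a Seidel switching. A graph $G$ is $S$-determined if every graph with the same Seidel spectrum as $G$ is switching equivalent to a graph isomorphic to $G$. *)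

(* Defs.v *)
From HB Require Import structures.
From mathcomp Require Import all_boot all_order all_algebra all_field.

Set Implicit Arguments.
Unset Strict Implicit.
Unset Printing Implicit Defensive.

Import GRing.Theory.
Local Open Scope ring_scope.

Record sgraph (V : finType) := SGraph {
  adj : rel V;
  adj_sym : symmetric adj;
  adj_irrefl : irreflexive adj
}.

(* Rows and columns are indexed by the vertices through enum_val. *)
Definition adjacency_mx (V : finType) (G : sgraph V) : 'M[algC]_#|V| :=
  \matrix_(i, j) (adj G (enum_val i) (enum_val j))%:R.

Definition seidel_mx (V : finType) (G : sgraph V) : 'M[algC]_#|V| :=
  const_mx 1 - 1%:M - 2%:R *: adjacency_mx G.

(* The roots, listed with multiplicity, of the (monic) characteristic         *)
(* polynomial. The order of the list is irrelevant: as a multiset it is to be *)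
(* compared up to perm_eq.                                                    *)
Definition spectrum (n : nat) (M : 'M[algC]_n) : seq algC :=
  sval (closed_field_poly_normal (char_poly M)).

Definition seidel_spectrum (V : finType) (G : sgraph V) : seq algC :=
  spectrum (seidel_mx G).

Definition switch_adj (V : finType) (G : sgraph V) (U : {set V}) : rel V :=
  fun x y => if (x \in U) == (y \in U) then adj G x y else ~~ adj G x y.

Lemma switch_adj_sym (V : finType) (G : sgraph V) (U : {set V}) :
  symmetric (switch_adj G U).
Proof. by move=> x y; rewrite /switch_adj eq_sym adj_sym. Qed.

Lemma switch_adj_irrefl (V : finType) (G : sgraph V) (U : {set V}) :
  irreflexive (switch_adj G U).
Proof. by move=> x; rewrite /switch_adj eqxx adj_irrefl. Qed.

(* The partition is U together with its complement; either may be empty. *)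
Definition switch (V : finType) (G : sgraph V) (U : {set V}) : sgraph V :=
  SGraph (switch_adj_sym G U) (switch_adj_irrefl G U).

Definition switching_equivalent (V : finType) (G H : sgraph V) : Prop :=
  exists U : {set V}, adj H =2 adj (switch G U).

Definition isomorphic (V W : finType) (G : sgraph V) (H : sgraph W) : Prop :=
  exists2 f : V -> W, bijective f & forall x y, adj H (f x) (f y) = adj G x y.

Definition S_determined (V : finType) (G : sgraph V) : Prop :=
  forall (W : finType) (H : sgraph W),
    perm_eq (seidel_spectrum H) (seidel_spectrum G) ->
    exists2 G' : sgraph W, switching_equivalent H G' & isomorphic G' G.

Definition multipartite_adj (I : finType) (n : I -> nat) :
    rel {i : I & 'I_(n i)} :=
  fun x y => tag x != tag y.

Lemma multipartite_adj_sym (I : finType) (n : I -> nat) :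
  symmetric (@multipartite_adj I n).
Proof. by move=> x y; rewrite /multipartite_adj eq_sym. Qed.

Lemma multipartite_adj_irrefl (I : finType) (n : I -> nat) :
  irreflexive (@multipartite_adj I n).
Proof. by move=> x; rewrite /multipartite_adj eqxx. Qed.

(* The parts are indexed by I, part i has n i vertices. *)
Definition complete_multipartite (I : finType) (n : I -> nat) :
    sgraph {i : I & 'I_(n i)} :=
  SGraph (@multipartite_adj_sym I n) (@multipartite_adj_irrefl I n).

(* Part (i, j), with j < s i, has size p i. *)
Definition complete_multipartite_rep (l : nat) (p s : 'I_l -> nat) :
    sgraph {k : {i : 'I_l & 'I_(s i)} & 'I_(p (tag k))} :=
  complete_multipartite (fun k : {i : 'I_l & 'I_(s i)} => p (tag k)).

(* Main.v *)
Require Import Defs.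
From HB Require Import structures.
From mathcomp Require Import all_boot all_order all_algebra all_field.
From mathcomp Require Import perm spectral sesquilinear ring.

Set Implicit Arguments.
Unset Strict Implicit.
Unset Printing Implicit Defensive.

Import Order.TTheory GRing.Theory Num.Theory.
Local Open Scope ring_scope.
Local Open Scope sesquilinear_scope.

(** For a complete multipartite graph, S + I arises from 2 I - J by repeating
    rows and columns, so its form is nonnegative on a hyperplane. This only
    depends on the spectrum, hence also holds for any cospectral H. Switch H so
    that a vertex v becomes isolated: changing the v-entry of a vector so that
    its entries sum to zero turns the form of S + I into that of - 2 A, so A has
    at most one positive eigenvalue. By an argument of Smith, H is then a
    complete multipartite graph plus isolated vertices, and switching the latter
    makes it complete multipartite.

    If G is complete multipartite on n vertices with part sizes p_1, ..., p_k
    (some possibly zero) and P = \prod_i (X - 2 p_i), then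
      2 X^k chi(S + I) = X^n (X P' - (k - 2) P).
    So for cospectral G and H with the same k, D = P - Q satisfies
    X D' = (k - 2) D, that is, D is a monomial. At a root a > 0 of P of
    multiplicity at least 3, X Q' - (k - 2) Q = X P' - (k - 2) P has a double
    root. If Q(a) were nonzero, the derivative of x Q'/Q would thus vanish at a,
    whereas it is negative there. So D(a) = 0, whence D = 0 and P = Q. *)

(** * Finite types *)

Lemma card_fiber_tag (I : finType) (n : I -> nat) (i : I) :
  #|[set u : {i : I & 'I_(n i)} | tag u == i]| = n i.
Proof.
pose tag_i (x : 'I_(n i)) := Tagged (fun i => 'I_(n i)) x.
have tag_i_inj : injective tag_i.
  by move=> x y /eqP; rewrite eq_Tagged => /eqP.
rewrite -[RHS]card_ord -(card_imset _ tag_i_inj); apply: eq_card => -[j x].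
rewrite inE; apply/eqP/imsetP => [/= ji|[y _ ->] //].
by rewrite ji in x *; exists x.
Qed.

Lemma count_map_enum (V : finType) (T : Type) (f : V -> T) (a : pred T) :
  count a (map f (enum V)) = #|[set x | a (f x)]|.
Proof. by rewrite count_map cardsE cardE enumT /enum_mem size_filter. Qed.

Lemma perm_eq_map_enum_bij (V W : finType) (T : eqType)
    (a : V -> T) (b : W -> T) :
  perm_eq (map a (enum V)) (map b (enum W)) ->
  exists2 f : V -> W, bijective f & forall x, b (f x) = a x.
Proof.
move=> perm_ab; have eqVW : #|V| = #|W|.
  by rewrite !cardE -(size_map a) (perm_size perm_ab) size_map.
pose bt : #|W|.-tuple T := [tuple of map b (enum_tuple W)].
have /tuple_permP[s aE] : perm_eq (map a (enum V)) bt by [].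
pose rank x := cast_ord eqVW (enum_rank x).
exists (fun x => enum_val (s (rank x))) => [|x].
  apply: inj_card_bij; last by rewrite eqVW.
  by move=> x y /enum_val_inj/perm_inj/cast_ord_inj/enum_rank_inj.
transitivity (tnth bt (s (rank x))).
  by rewrite tnth_map (tnth_nth (enum_default (s (rank x)))).
have := congr1 (nth (a x) ^~ (rank x)) aE.
by rewrite -tnth_nth tnth_mktuple (nth_map x) -?cardE //= nth_enum_rank.
Qed.

(** * Determinants and characteristic polynomials *)

Lemma det_scalar_sub_mulmxC (R : comNzRingType) m n (a : R)
    (A : 'M_(m, n)) (B : 'M_(n, m)) :
  a ^+ n * \det (a%:M - A *m B) = a ^+ m * \det (a%:M - B *m A).
Proof.
pose K := block_mx a%:M A B 1%:M.
have <- : \det K = \det (a%:M - A *m B).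
  have <- : \det (K *m block_mx 1%:M 0 (- B) 1%:M) = \det K.
    by rewrite det_mulmx det_lblock !det1 !mulr1.
  rewrite mulmx_block !mulmx1 !mulmx0 !mulmxN mul1mx subrr !add0r.
  by rewrite det_ublock det1 mulr1.
have <- : \det (block_mx 1%:M 0 (- B) a%:M *m K) = a ^+ n * \det K.
  by rewrite det_mulmx det_lblock det1 mul1r det_scalar.
rewrite mulmx_block !mul1mx !mul0mx !addr0 mulNmx mul_mx_scalar mul_scalar_mx.
by rewrite addNr mulNmx mulmx1 addrC det_ublock det_scalar.
Qed.

Lemma char_poly_mulmxC (R : comNzRingType) m n
    (A : 'M[R]_(m, n)) (B : 'M_(n, m)) :
  'X^n * char_poly (A *m B) = 'X^m * char_poly (B *m A).
Proof.
by rewrite /char_poly /char_poly_mx !map_mxM; apply: det_scalar_sub_mulmxC.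
Qed.

Lemma char_poly_conjugate (R : comNzRingType) n (A P Q : 'M[R]_n) :
  Q *m P = 1%:M -> char_poly (P *m A *m Q) = char_poly A.
Proof.
move=> QP; apply: (monic_lreg (monicXn R n)).
by rewrite char_poly_mulmxC mulmxA QP mul1mx.
Qed.

Lemma char_poly_add_scalar (R : comNzRingType) n (A : 'M[R]_n) (a : R) :
  char_poly (A + a%:M) = char_poly A \Po ('X - a%:P).
Proof.
rewrite /char_poly -det_map_mx; congr (\det _); apply/matrixP=> i j.
rewrite !mxE /= rmorphB rmorphMn /= comp_polyX comp_polyC polyCD polyCMn.
by case: (i == j); rewrite ?mulr1n ?mulr0n ?addr0 // opprD addrA addrAC.
Qed.

Lemma mxsub_mul1 (R : pzSemiRingType) m n (f : 'I_m -> 'I_n) (A : 'M[R]_n) :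
  rowsub f 1%:M *m A *m colsub f 1%:M = mxsub f f A.
Proof. by rewrite mul_rowsub_mx mul1mx mulmx_colsub mulmx1 -mxsubcr. Qed.

Lemma colsub_rowsub1 (R : pzSemiRingType) m n (f : 'I_m -> 'I_n) :
  colsub f 1%:M *m rowsub f 1%:M =
    diag_mx (\row_j #|[set i | f i == j]|%:R) :> 'M[R]_n.
Proof.
apply/matrixP=> i j; rewrite !mxE.
transitivity (\sum_k (i == j)%:R * (f k == i)%:R : R).
  apply: eq_bigr => k _; rewrite !mxE [i == f k]eq_sym.
  by case: eqVneq => [->|_]; rewrite ?(mulr0n, mul0r, mulr0) // mulr1 mul1r.
rewrite -mulr_sumr -sum1dep_card natr_sum [in RHS]big_mkcond mulr_natl.
by congr (_ *+ _); apply: eq_bigr => k _; case: eqP.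
Qed.

Lemma char_poly_mxsub (R : comNzRingType) m n (f : 'I_m -> 'I_n)
    (A : 'M[R]_n) :
  'X^n * char_poly (mxsub f f A) =
    'X^m * char_poly (A *m diag_mx (\row_j #|[set i | f i == j]|%:R)).
Proof.
by rewrite -mxsub_mul1 -mulmxA char_poly_mulmxC -mulmxA colsub_rowsub1.
Qed.

(* With a the product of the entries of d and w_i = u_i \prod_(j != i) d_j, one
   has diag_mx d *m (a%:M + w *m v) = a *: (diag_mx d + u *m v). *)
Lemma det_diag_add_rank1 (R : comNzRingType) n (d v : 'rV[R]_n) (u : 'cV_n) :
  GRing.lreg (\prod_i d 0 i) ->
  \det (diag_mx d + u *m v) =
    \prod_i d 0 i + \sum_i v 0 i * u i 0 * \prod_(j | j != i) d 0 j.
Proof.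
set a := \prod_i _ => reg_a.
pose w : 'cV_n := \col_i (u i 0 * \prod_(j | j != i) d 0 j).
have diag_w : diag_mx d *m w = a *: u.
  apply/colP=> i; rewrite mul_diag_mx !mxE mulrCA mulrC.
  by rewrite [in RHS]/a [in RHS](bigD1 i).
have factor : diag_mx d *m (a%:M + w *m v) = a *: (diag_mx d + u *m v).
  by rewrite mulmxDr mul_mx_scalar mulmxA diag_w -scalemxAl scalerDr.
have det_factor : a * \det (a%:M + w *m v) = a ^+ n * (a + (v *m w) 0 0).
  have := det_scalar_sub_mulmxC a w (- v).
  by rewrite expr1 mulmxN mulNmx !opprK det_mx11 !mxE mulr1n.
apply: (@lregX _ a n.+1 reg_a).
rewrite exprS -mulrA -detZ -factor det_mulmx det_diag -/a det_factor mulrA.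
congr (_ * (_ + _)); rewrite mxE.
by apply: eq_bigr => i _; rewrite mxE mulrA.
Qed.

(** * The operator X P' - r P *)

Lemma deriv_prod (R : comNzRingType) (I : finType) (F : I -> {poly R}) :
  (\prod_i F i)^`() = \sum_i (F i)^`() * \prod_(j | j != i) F j.
Proof.
suff deriv_prod_seq (r : seq I) : uniq r -> (\prod_(i <- r) F i)^`() =
    \sum_(i <- r) (F i)^`() * \prod_(j <- r | j != i) F j.
  by rewrite deriv_prod_seq ?index_enum_uniq.
elim: r => [|k r IHr] /=; first by rewrite !big_nil -polyC1 derivC.
case/andP=> k_notin_r /IHr{}IHr; rewrite !big_cons derivM IHr eqxx.
congr (_ * _ + _).
  rewrite big_seq [RHS]big_seq_cond; apply: eq_bigl => j.
  by case: eqVneq => [->|]; rewrite ?andbT // (negbTE k_notin_r).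
rewrite mulr_sumr big_seq [RHS]big_seq; apply: eq_bigr => i ir.
rewrite big_cons mulrCA; case: eqVneq => // ki.
by rewrite ki ir in k_notin_r.
Qed.

Definition euler_op (R : comNzRingType) (r : R) (p : {poly R}) : {poly R} :=
  'X * p^`() - r *: p.

Lemma euler_opB (R : comNzRingType) (r : R) (p q : {poly R}) :
  euler_op r (p - q) = euler_op r p - euler_op r q.
Proof. by rewrite /euler_op derivB -!mul_polyC; ring. Qed.

Lemma coef_euler_op (R : comNzRingType) (r : R) (p : {poly R}) i :
  (euler_op r p)`_i = (i%:R - r) * p`_i.
Proof.
rewrite coefB coefXM coefZ coef_deriv mulrBl; congr (_ - _).
by case: i => [|i]; rewrite ?mul0r // mulr_natl.
Qed.

Lemma euler_op_eq0_root (F : numFieldType) (r a : F) (p : {poly F}) :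
  a != 0 -> euler_op r p = 0 -> root p a -> p = 0.
Proof.
move=> a_neq0 Ep pa; apply/eqP; apply: contraTT pa => p_neq0.
have coef_p i : (i%:R == r) || (p`_i == 0).
  by rewrite -subr_eq0 -mulf_eq0 -coef_euler_op Ep coef0.
pose m := (size p).-1.
have lead_neq0 : p`_m != 0 by rewrite -lead_coefE lead_coef_eq0.
have /eqP mE : m%:R == r by have := coef_p m; rewrite (negbTE lead_neq0) orbF.
have -> : p = p`_m *: 'X^m.
  apply/polyP=> i; rewrite coefZ coefXn.
  case: eqVneq => [->|im]; rewrite ?mulr1 // mulr0; apply/eqP.
  by have := coef_p i; rewrite -mE eqr_nat (negbTE im).
by rewrite rootE !hornerE mulf_neq0 ?expf_neq0.
Qed.

Lemma dvdp_exp_XsubC_euler_op (F : fieldType) (r a : F) n (p : {poly F}) :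
  ('X - a%:P) ^+ n.+1 %| p -> ('X - a%:P) ^+ n %| euler_op r p.
Proof.
have dvdS : ('X - a%:P) ^+ n %| ('X - a%:P) ^+ n.+1 by apply: dvdp_exp2l.
case/dvdpP=> q ->; apply: dvdp_sub; last by rewrite -mul_polyC !dvdp_mull.
rewrite derivM deriv_exp -mulr_natl dvdp_mull // dvdp_add //.
  by rewrite dvdp_mull.
by rewrite !dvdp_mull.
Qed.

Lemma char_poly_two_sub_ones_diag (R : comNzRingType) k (d : 'rV[R]_k) :
  2 *: char_poly ((2%:M - const_mx 1) *m diag_mx d) =
    euler_op (k%:R - 2) (\prod_i ('X - (2 * d 0 i)%:P)).
Proof.
set P := \prod_i _.
pose e : 'rV[{poly R}]_k := \row_i ('X - (2 * d 0 i)%:P).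
have prod_e : \prod_i e 0 i = P by apply: eq_bigr => i _; rewrite mxE.
have -> : char_poly ((2%:M - const_mx 1) *m diag_mx d) =
    P + \sum_i (d 0 i)%:P * \prod_(j | j != i) e 0 j.
  rewrite -prod_e /char_poly /char_poly_mx.
  have -> : 'X%:M - map_mx polyC ((2%:M - const_mx 1) *m diag_mx d) =
      diag_mx e + const_mx 1 *m map_mx polyC d.
    rewrite mul_mx_diag; apply/matrixP=> i j; rewrite !mxE big_ord1 !mxE mul1r.
    by case: eqVneq => [->|_]; rewrite !(mulr1n, mulr0n) ?polyCM ?polyCB; ring.
  rewrite det_diag_add_rank1; last first.
    by rewrite prod_e; apply/monic_lreg/monic_prod_XsubC.
  by congr (_ + _); apply: eq_bigr => i _; rewrite !mxE mulr1.
rewrite /euler_op -[in P^`()]prod_e deriv_prod.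
have sum_prod_e : k%:R *: P = \sum_i e 0 i * \prod_(j | j != i) e 0 j.
  transitivity (\sum_(i < k) P).
    by rewrite sumr_const card_ord scaler_nat.
  by apply: eq_bigr => i _; rewrite -prod_e (bigD1 i).
rewrite scalerBl opprB sum_prod_e scalerDr addrCA; congr (_ + _).
rewrite mulr_sumr scaler_sumr -sumrB; apply: eq_bigr => i _.
by rewrite !mxE derivXsubC mul1r -!mul_polyC polyCM; ring.
Qed.

(* euler_wronskian p / p^2 is the derivative of x p'/p, that is
   - \sum_b b / (x - b)^2 when p = \prod_b (x - b). *)
Definition euler_wronskian (R : comNzRingType) (p : {poly R}) : {poly R} :=
  p * ('X * p^`())^`() - p^`() * ('X * p^`()).

Lemma euler_wronskianE (R : comNzRingType) (r : R) (p : {poly R}) :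
  euler_wronskian p = p * (euler_op r p)^`() - p^`() * euler_op r p.
Proof. by rewrite /euler_wronskian /euler_op !derivE -!mul_polyC; ring. Qed.

Lemma euler_wronskianM (R : comNzRingType) (p q : {poly R}) :
  euler_wronskian (p * q) =
    euler_wronskian p * q ^+ 2 + p ^+ 2 * euler_wronskian q.
Proof. by rewrite /euler_wronskian !derivE; ring. Qed.

Lemma euler_wronskianXsubC (R : comNzRingType) (b : R) :
  euler_wronskian ('X - b%:P) = - b%:P.
Proof. by rewrite /euler_wronskian derivXsubC mulr1 derivX; ring. Qed.

Lemma horner_euler_wronskian_XsubCM (R : comNzRingType) (a b : R)
    (p : {poly R}) :
  (euler_wronskian (('X - b%:P) * p)).[a] =
    (a - b) ^+ 2 * (euler_wronskian p).[a] - b * p.[a] ^+ 2.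
Proof.
rewrite euler_wronskianM euler_wronskianXsubC.
by move: (euler_wronskian p) => w; rewrite !hornerE /=; ring.
Qed.

Section NonnegRoots.

Variables (F : numFieldType) (a : F).
Hypothesis a_real : a \is Num.real.

Lemma sqr_horner_prod_XsubC_ge0 (s : seq F) :
  {in s, forall b, b \is Num.real} ->
  0 <= (\prod_(b <- s) ('X - b%:P)).[a] ^+ 2.
Proof.
move=> s_real; rewrite real_exprn_even_ge0 // horner_prod big_seq rpred_prod //.
by move=> b /s_real b_real; rewrite !hornerE rpredB.
Qed.

Lemma euler_wronskian_prod_XsubC_le0 (s : seq F) :
  {in s, forall b, 0 <= b} ->
  (euler_wronskian (\prod_(b <- s) ('X - b%:P))).[a] <= 0.
Proof.
elim: s => [|b s IHs] s_ge0.
  rewrite big_nil /euler_wronskian -polyC1 derivC mulr0 mul0r subr0.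
  by rewrite derivC mulr0 horner0.
have b_ge0 : 0 <= b by rewrite s_ge0 ?mem_head.
have {}s_ge0 : {in s, forall c, 0 <= c}.
  by move=> c cs; rewrite s_ge0 // inE cs orbT.
rewrite big_cons horner_euler_wronskian_XsubCM subr_le0.
apply: (@le_trans _ _ 0).
  by rewrite mulr_ge0_le0 ?IHs // real_exprn_even_ge0 ?rpredB // ger0_real.
by rewrite mulr_ge0 // sqr_horner_prod_XsubC_ge0 // => c /s_ge0/ger0_real.
Qed.

Lemma euler_wronskian_prod_XsubC_lt0 (s : seq F) :
  {in s, forall b, 0 <= b} -> (exists2 b, b \in s & 0 < b) -> a \notin s ->
  (euler_wronskian (\prod_(b <- s) ('X - b%:P))).[a] < 0.
Proof.
move=> s_ge0 [b bs b_gt0] a_notin_s.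
have rem_ge0 : {in rem b s, forall c, 0 <= c} by move=> c /mem_rem/s_ge0.
have rem_real : {in rem b s, forall c, c \is Num.real}.
  by move=> c /rem_ge0/ger0_real.
rewrite (big_rem b bs) horner_euler_wronskian_XsubCM subr_lt0 /=.
apply: (@le_lt_trans _ _ 0).
  rewrite mulr_ge0_le0 ?euler_wronskian_prod_XsubC_le0 //.
  by rewrite real_exprn_even_ge0 // rpredB // gtr0_real.
rewrite mulr_gt0 // lt0r sqr_horner_prod_XsubC_ge0 ?andbT // sqrf_eq0.
by rewrite -rootE root_prod_XsubC; apply: contra a_notin_s => /mem_rem.
Qed.

End NonnegRoots.

Lemma prod_XsubC_euler_op_inj (F : numFieldType) (r a : F) (s t : seq F)
    (P := \prod_(b <- s) ('X - b%:P)) (Q := \prod_(b <- t) ('X - b%:P)) :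
  0 < a -> (2 < count_mem a s)%N ->
  {in t, forall b, 0 <= b} -> (exists2 b, b \in t & 0 < b) ->
  euler_op r P = euler_op r Q -> P = Q.
Proof.
move=> a_gt0 a_triple t_ge0 t_gt0 eqPQ.
have P_neq0 : P != 0 by rewrite monic_neq0 ?monic_prod_XsubC.
have dvdP : ('X - a%:P) ^+ 3 %| P by rewrite -mup_geq ?mu_prod_XsubC.
have /dvdpP[q EP] := dvdp_exp_XsubC_euler_op r dvdP.
have Pa : root P a.
  by rewrite root_prod_XsubC -has_pred1 has_count (ltn_trans _ a_triple).
have Qa : root Q a.
  rewrite root_prod_XsubC; apply/negPn/negP=> a_notin_t.
  have a_real := gtr0_real a_gt0.
  have := euler_wronskian_prod_XsubC_lt0 a_real t_ge0 t_gt0 a_notin_t.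
  suff -> : (euler_wronskian Q).[a] = 0 by rewrite ltxx.
  by rewrite (euler_wronskianE r) -eqPQ EP !derivE !hornerE /=; ring.
apply/eqP; rewrite -subr_eq0; apply/eqP.
apply: (@euler_op_eq0_root _ r a); first by rewrite gt_eqF.
  by rewrite euler_opB eqPQ subrr.
by rewrite rootE !hornerE (rootP Qa) (rootP Pa) subr0.
Qed.

(** * Hermitian forms and spectra *)

Section HermitianForm.

Variable C : numClosedFieldType.

Lemma trmxC_mul m n p (A : 'M[C]_(m, n)) (B : 'M_(n, p)) :
  (A *m B)^t* = B^t* *m A^t*.
Proof. by rewrite trmx_mul map_mxM. Qed.

Lemma trmxC_rowsub1 m n (f : 'I_m -> 'I_n) :
  (rowsub f 1%:M : 'M[C]_(m, n))^t* = colsub f 1%:M.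
Proof. by apply/matrixP=> i j; rewrite !mxE rmorph_nat eq_sym. Qed.

Lemma diag_dominant_form_gt0 (p q r a b : C) :
  0 <= r -> r < p -> r < q -> (a != 0) || (b != 0) ->
  0 < p * (a * a^*) + q * (b * b^*) + r * (a * b^* + b * a^*).
Proof.
move=> r_ge0 r_lt_p r_lt_q ab_neq0.
have -> : p * (a * a^*) + q * (b * b^*) + r * (a * b^* + b * a^*) =
    (p - r) * (a * a^*) + (q - r) * (b * b^*) + r * ((a + b) * (a + b)^*).
  by rewrite rmorphD /=; ring.
have pr_gt0 : 0 < p - r by rewrite subr_gt0.
have qr_gt0 : 0 < q - r by rewrite subr_gt0.
apply: ltr_pwDl; last by rewrite mulr_ge0 ?mul_conjC_ge0.
case/orP: ab_neq0 => [a_neq0|b_neq0]; [apply: ltr_pwDl | apply: ltr_pwDr].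
- by rewrite mulr_gt0 ?mul_conjC_gt0.
- by rewrite mulr_ge0 ?mul_conjC_ge0 // ltW.
- by rewrite mulr_gt0 ?mul_conjC_gt0.
- by rewrite mulr_ge0 ?mul_conjC_ge0 // ltW.
Qed.

Definition hermitian_form n (A : 'M[C]_n) (w : 'rV_n) : C :=
  (w *m A *m w^t*) 0 0.

(* For a Hermitian A this says that A has at most k negative eigenvalues. *)
Definition nonneg_in_codim (k n : nat) (A : 'M[C]_n) : Prop :=
  exists u : 'M[C]_(n, k), forall w : 'rV_n,
    w *m u = 0 -> 0 <= hermitian_form A w.

Lemma nonneg_in_codim_congruence k m n (A : 'M[C]_n) (X : 'M_(m, n)) :
  nonneg_in_codim k A -> nonneg_in_codim k (X *m A *m X^t*).
Proof.
case=> u u_ge0; exists (X *m u) => w; rewrite mulmxA => /u_ge0.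
by rewrite /hermitian_form trmxC_mul !mulmxA.
Qed.

Lemma nonneg_in_codimZ k n (A : 'M[C]_n) (a : C) :
  0 <= a -> nonneg_in_codim k A -> nonneg_in_codim k (a *: A).
Proof.
move=> a_ge0 [u u_ge0]; exists u => w /u_ge0 w_ge0.
by rewrite /hermitian_form -scalemxAr -scalemxAl mxE mulr_ge0.
Qed.

Lemma nonneg_in_codim_mxsub k m n (f : 'I_m -> 'I_n) (A : 'M[C]_n) :
  nonneg_in_codim k A -> nonneg_in_codim k (mxsub f f A).
Proof.
move/(nonneg_in_codim_congruence (rowsub f 1%:M)).
by rewrite trmxC_rowsub1 mxsub_mul1.
Qed.

Lemma nonneg_in_codim_negdef_leq k m n (A : 'M[C]_n) (X : 'M_(m, n)) :
  nonneg_in_codim k A ->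
  (forall z : 'rV_m, z != 0 -> hermitian_form A (z *m X) < 0) -> (m <= k)%N.
Proof.
move=> [u u_ge0] X_lt0; rewrite leqNgt; apply/negP=> k_lt_m.
have /rowV0Pn[z /sub_kermxP zXu z_neq0] : kermx (X *m u) != 0.
  rewrite -mxrank_eq0 mxrank_ker subn_eq0 -ltnNge.
  exact: leq_ltn_trans (rank_leq_col _) k_lt_m.
by have := lt_geF (X_lt0 z z_neq0); rewrite u_ge0 // -mulmxA.
Qed.

Lemma nonneg_in_codim1_plane n (A : 'M[C]_n) (v w : 'rV_n) :
  nonneg_in_codim 1 A ->
  ~ forall a b, (a != 0) || (b != 0) -> hermitian_form A (a *: v + b *: w) < 0.
Proof.
move=> nonnegA vw_lt0; suff : (1 + 1 <= 1)%N by [].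
apply: (nonneg_in_codim_negdef_leq (X := col_mx v w) nonnegA) => z.
rewrite -[z]hsubmxK [lsubmx z]mx11_scalar [rsubmx z]mx11_scalar => z_neq0.
rewrite mul_row_col !mul_scalar_mx; apply: vw_lt0.
apply: contraNT z_neq0; rewrite negb_or !negbK => /andP[/eqP-> /eqP->].
by rewrite !raddf0 row_mx0.
Qed.

Lemma nonneg_in_codim1_two_sub_ones n :
  nonneg_in_codim 1 (2%:M - const_mx 1 : 'M[C]_n).
Proof.
exists (const_mx 1) => w w_sum0; rewrite /hermitian_form.
have -> : const_mx 1 = (const_mx 1 : 'cV[C]_n) *m (const_mx 1 : 'rV_n).
  by apply/matrixP=> i j; rewrite !mxE big_ord1 !mxE mulr1.
rewrite mulmxBr mulmxA w_sum0 mul0mx subr0 mul_mx_scalar -scalemxAl mxE.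
by rewrite -dotmxE mulr_ge0 ?dnorm_ge0.
Qed.

End HermitianForm.

Lemma char_poly_spectrum n (A : 'M[algC]_n) :
  char_poly A = \prod_(z <- spectrum A) ('X - z%:P).
Proof.
rewrite /spectrum; case: closed_field_poly_normal => r /= {1}->.
by rewrite (monicP (char_poly_monic A)) scale1r.
Qed.

Lemma perm_spectrum_char_poly m n (A : 'M[algC]_m) (B : 'M[algC]_n) :
  perm_eq (spectrum A) (spectrum B) <-> char_poly A = char_poly B.
Proof.
rewrite !char_poly_spectrum; split; first by move/(perm_big _) => ->.
exact: prod_XsubC_eq.
Qed.

Lemma hermitian_diagonalization n (A : 'M[algC]_n) : A \is hermsymmx ->
  exists2 P : 'M[algC]_n, P \is unitarymx & exists2 d : 'rV_n,
    A = P^t* *m diag_mx d *m P & perm_eq (spectrum A) (map (d 0) (enum 'I_n)).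
Proof.
move=> hermA; have /orthomx_spectralP := hermitian_normalmx hermA.
set P := spectralmx A; set d := spectral_diag A.
have unitaryP : P \is unitarymx := spectral_unitarymx A.
rewrite invmx_unitary // => AE; exists P => //; exists d => //.
apply: prod_XsubC_eq; rewrite -char_poly_spectrum AE.
rewrite char_poly_conjugate; last exact/unitarymxP.
rewrite char_poly_trig ?diag_mx_is_trig // big_map big_enum.
by apply: eq_bigr => i _; rewrite !mxE eqxx mulr1n.
Qed.

Lemma isospectral_isometry m n (A : 'M[algC]_m) (B : 'M[algC]_n) :
  A \is hermsymmx -> B \is hermsymmx -> perm_eq (spectrum A) (spectrum B) ->
  exists2 U : 'M_(m, n), U \is unitarymx & A = U *m B *m U^t*.
Proof.
case/hermitian_diagonalization=> P unitaryP [d AE specA].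
case/hermitian_diagonalization=> Q unitaryQ [e BE specB] specAB.
have [f f_bij fE] :
    exists2 f : 'I_m -> 'I_n, bijective f & forall i, e 0 (f i) = d 0 i.
  by apply: perm_eq_map_enum_bij; rewrite -(permPl specA) (permPl specAB).
pose S : 'M[algC]_(m, n) := rowsub f 1%:M.
have mxsub_diag (c : 'rV[algC]_n) :
    mxsub f f (diag_mx c) = diag_mx (\row_i c 0 (f i)).
  by apply/matrixP=> i j; rewrite !mxE (bij_eq f_bij).
have unitaryS : S \is unitarymx.
  apply/unitarymxP; rewrite trmxC_rowsub1 -[S]mulmx1 mxsub_mul1.
  rewrite -!diag_const_mx mxsub_diag.
  by congr diag_mx; apply/rowP=> i; rewrite !mxE.
have diag_d : diag_mx d = S *m diag_mx e *m S^t*.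
  rewrite trmxC_rowsub1 mxsub_mul1 mxsub_diag.
  by congr diag_mx; apply/rowP=> i; rewrite mxE fE.
exists (P^t* *m S *m Q); first by rewrite !mul_unitarymx // trmxC_unitary.
by rewrite AE BE diag_d !trmxC_mul trmxCK !mulmxA !(mulmxtVK _ unitaryQ).
Qed.

Lemma nonneg_in_codim_isospectral k m n (A : 'M[algC]_m) (B : 'M[algC]_n)
    (a : algC) :
  A \is hermsymmx -> B \is hermsymmx -> perm_eq (spectrum A) (spectrum B) ->
  nonneg_in_codim k (B + a%:M) -> nonneg_in_codim k (A + a%:M).
Proof.
move=> hermA hermB /(isospectral_isometry hermA hermB)[U /unitarymxP UU AE].
move/(nonneg_in_codim_congruence U).
by rewrite mulmxDr mulmxDl -AE mul_mx_scalar -scalemxAl UU scalemx1.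
Qed.

(** * Seidel matrices and switching *)

Lemma seidel_mx_hermitian (V : finType) (G : sgraph V) :
  seidel_mx G \is hermsymmx.
Proof.
apply/is_hermitianmxP; rewrite expr0 scale1r; apply/matrixP=> i j.
by rewrite !mxE adj_sym (eq_sym j i) !rmorphB rmorphM /= !rmorph_nat rmorph1.
Qed.

Lemma nonneg_in_codim_seidel_isospectral k (V W : finType)
    (G : sgraph V) (H : sgraph W) :
  perm_eq (seidel_spectrum H) (seidel_spectrum G) ->
  nonneg_in_codim k (seidel_mx G + 1%:M) ->
  nonneg_in_codim k (seidel_mx H + 1%:M).
Proof. by apply: nonneg_in_codim_isospectral; apply: seidel_mx_hermitian. Qed.

Lemma card_isospectral (V W : finType) (G : sgraph V) (H : sgraph W) :
  perm_eq (seidel_spectrum H) (seidel_spectrum G) -> #|W| = #|V|.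
Proof.
move/perm_spectrum_char_poly=> chiHG; apply: succn_inj.
by rewrite -(size_char_poly (seidel_mx H)) chiHG; apply: size_char_poly.
Qed.

Lemma seidel_spectrum_switching (V : finType) (G H : sgraph V) :
  switching_equivalent G H ->
  perm_eq (seidel_spectrum H) (seidel_spectrum G).
Proof.
case=> U switchE; apply/perm_spectrum_char_poly.
pose D : 'M[algC]_#|V| := diag_mx (\row_i (-1) ^+ (enum_val i \in U)).
have DD : D *m D = 1%:M.
  rewrite mulmx_diag -diag_const_mx; congr diag_mx; apply/rowP=> i.
  by rewrite !mxE -expr2 sqrr_sign.
rewrite -[RHS](char_poly_conjugate _ DD); congr char_poly.
apply/matrixP=> i j; rewrite mul_mx_diag mxE mul_diag_mx !mxE switchE /=.
rewrite /switch_adj; case: eqVneq => [->|_].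
  by rewrite eqxx mulrAC -expr2 sqrr_sign mul1r.
case: (_ \in U); case: (_ \in U); case: adj => /=.
all: by rewrite ?expr0 ?expr1; ring.
Qed.

Lemma switching_equivalent_trans (V : finType) (G1 G2 G3 : sgraph V) :
  switching_equivalent G1 G2 -> switching_equivalent G2 G3 ->
  switching_equivalent G1 G3.
Proof.
case=> U G2E [W G3E]; exists ((U :\: W) :|: (W :\: U)) => x y.
rewrite G3E /= /switch_adj G2E /= /switch_adj !inE.
case: (x \in U); case: (x \in W); case: (y \in U); case: (y \in W).
all: by rewrite /= ?negbK.
Qed.

(* Let X subtract from each row vector its sum times e_v. As v is isolated,
   X (S + I) X^* = - 2 A. *)
Lemma nonneg_in_codim_adjacency k (V : finType) (G : sgraph V) (v : V) :
  (forall x, adj G v x = false) ->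
  nonneg_in_codim k (seidel_mx G + 1%:M) ->
  nonneg_in_codim k (- adjacency_mx G).
Proof.
move=> v_isolated.
pose ev : 'rV[algC]_#|V| := delta_mx 0 (enum_rank v).
pose X : 'M[algC]_#|V| := 1%:M - (const_mx 1 : 'cV_ _) *m ev.
have XA : X *m adjacency_mx G = adjacency_mx G.
  have evA : ev *m adjacency_mx G = 0.
    by rewrite -rowE; apply/rowP=> i; rewrite !mxE enum_rankK v_isolated.
  by rewrite mulmxBl mul1mx -mulmxA evA mulmx0 subr0.
have trmxC_A : (adjacency_mx G)^t* = adjacency_mx G.
  by apply/matrixP=> i j; rewrite !mxE rmorph_nat adj_sym.
have AX : adjacency_mx G *m X^t* = adjacency_mx G.
  by rewrite -[in LHS]trmxC_A -trmxC_mul XA.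
have XJ : X *m const_mx 1 = 0 :> 'M[algC]_#|V|.
  have evJ : ev *m const_mx 1 = const_mx 1 :> 'rV_#|V|.
    by rewrite -rowE; apply/rowP=> i; rewrite !mxE.
  rewrite mulmxBl mul1mx -mulmxA evJ; apply/matrixP=> i j.
  by rewrite !mxE big_ord1 !mxE mulr1 subrr.
move/(nonneg_in_codim_congruence X).
have -> : seidel_mx G + 1%:M = const_mx 1 - 2 *: adjacency_mx G.
  by rewrite /seidel_mx addrAC subrK.
rewrite mulmxBr XJ sub0r -scalemxAr XA mulNmx -scalemxAl AX.
have half_ge0 : 0 <= 2^-1 :> algC by rewrite invr_ge0 ler0n.
move/(nonneg_in_codimZ half_ge0).
by rewrite scalerN scalerA mulVf ?pnatr_eq0 // scale1r.
Qed.

(* If zw were an edge, the form of A would be positive definite on the plane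
   spanned by 2 e_x + 2 e_y and 3 e_z + e_w. *)
Lemma nonadj_edge_isolated (V : finType) (G : sgraph V) (x y z w : V) :
  nonneg_in_codim 1 (- adjacency_mx G) ->
  adj G x y -> ~~ adj G z x -> ~~ adj G z y -> ~~ adj G z w.
Proof.
move=> nonnegA xy /negbTE zx /negbTE zy; apply/negP=> zw.
pose f (i : 'I_4) := enum_rank (nth x [:: x; y; z; w] i).
pose exy : 'rV[algC]_4 := \row_j [:: 2; 2; 0; 0]`_j.
pose ezw : 'rV[algC]_4 := \row_j [:: 0; 0; 3; 1]`_j.
apply: (nonneg_in_codim1_plane (v := exy) (w := ezw)
  (nonneg_in_codim_mxsub f nonnegA)) => a b ab_neq0.
pose e : algC := (adj G w x)%:R + (adj G w y)%:R.
have -> : hermitian_form (mxsub f f (- adjacency_mx G)) (a *: exy + b *: ezw) =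
    - (8 * (a * a^*) + 6 * (b * b^*) + 2 * e * (a * b^* + b * a^*)).
  rewrite /hermitian_form !mxE !big_ord_recl big_ord0 !mxE.
  rewrite !big_ord_recl !big_ord0 !mxE !enum_rankK /=.
  rewrite !adj_irrefl !(adj_sym G _ z) ![adj G y x]adj_sym ![adj G _ w]adj_sym.
  rewrite !zx !zy [adj G w z]adj_sym zw xy /e.
  by rewrite !rmorphD !rmorphM !rmorph_nat /=; ring.
have /andP[e_ge0 e_le4] : 0 <= 2 * e <= 4.
  by rewrite /e -natrD -natrM ler0n ler_nat; do 2!case: (adj G w _).
by rewrite oppr_lt0 diag_dominant_form_gt0 // (le_lt_trans e_le4) ?ltr_nat.
Qed.

(** * Complete multipartite graphs *)

Section Multipartite.

Variables (V I : finType) (G : sgraph V) (c : V -> I).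

Definition multipartite_coloring : Prop :=
  forall x y, adj G x y = (c x != c y).

Definition part_size (i : I) : nat := #|[set x | c x == i]|.

Definition part_sizes : seq nat := map part_size (enum I).

Definition part_roots : seq algC := [seq 2 * n%:R | n <- part_sizes].

Definition part_poly : {poly algC} := \prod_(b <- part_roots) ('X - b%:P).

Definition part_rank (k : 'I_#|V|) : 'I_#|I| := enum_rank (c (enum_val k)).

Lemma card_fiber_part_rank (k : 'I_#|I|) :
  #|[set j | part_rank j == k]| = part_size (enum_val k).
Proof.
rewrite -[RHS](on_card_preimset (onW_bij _ (enum_val_bij V))).
by apply: eq_card => j; rewrite !inE (can2_eq enum_rankK enum_valK).
Qed.

Hypothesis coloring_c : multipartite_coloring.

Lemma seidel_mx_multipartite :
  seidel_mx G + 1%:M = mxsub part_rank part_rank (2%:M - const_mx 1).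
Proof.
apply/matrixP=> i j; rewrite !mxE coloring_c (inj_eq enum_rank_inj).
by case: (c _ == _); rewrite /= ?(mulr1n, mulr0n); ring.
Qed.

Lemma nonneg_in_codim1_multipartite :
  nonneg_in_codim 1 (seidel_mx G + 1%:M).
Proof.
rewrite seidel_mx_multipartite; apply: nonneg_in_codim_mxsub.
exact: nonneg_in_codim1_two_sub_ones.
Qed.

Lemma char_poly_seidel_multipartite :
  'X^#|I| * (2 *: char_poly (seidel_mx G + 1%:M)) =
    'X^#|V| * euler_op (#|I|%:R - 2) part_poly.
Proof.
rewrite seidel_mx_multipartite -scalerAr char_poly_mxsub scalerAr.
rewrite char_poly_two_sub_ones_diag; congr (_ * euler_op _ _).
rewrite /part_poly 2!big_map big_enum [RHS](big_enum_val _).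
by apply: eq_bigr => i _; rewrite mxE card_fiber_part_rank.
Qed.

End Multipartite.

Lemma nonadj_trans_multipartite_coloring (V : finType) (G : sgraph V) :
  (forall y x z, ~~ adj G x y -> ~~ adj G y z -> ~~ adj G x z) ->
  exists c : V -> {set V}, multipartite_coloring G c.
Proof.
move=> nonadj_trans; pose nonadj x := [set y | ~~ adj G x y].
exists nonadj => x y.
suff -> : (nonadj x == nonadj y) = ~~ adj G x y by rewrite negbK.
apply/eqP/idP => [/setP/(_ y)|nxy]; first by rewrite !inE adj_irrefl.
apply/setP=> z; rewrite !inE.
by apply/idP/idP; apply: nonadj_trans; rewrite // adj_sym.
Qed.

Definition isolated_vertices (V : finType) (G : sgraph V) : {set V} :=
  [set x | [forall y, ~~ adj G x y]].

Lemma adj_isolated (V : finType) (G : sgraph V) x y :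
  x \in isolated_vertices G -> adj G x y = false.
Proof. by rewrite inE => /forallP/(_ y)/negbTE. Qed.

Lemma adj_switch_isolated (V : finType) (G : sgraph V)
    (U := isolated_vertices G) x y :
  adj (switch G U) x y = ((x \in U) != (y \in U)) || adj G x y.
Proof.
rewrite /= /switch_adj.
case: (boolP (x \in U)); case: (boolP (y \in U)) => //= yU xU.
  by rewrite adj_isolated.
by rewrite adj_sym adj_isolated.
Qed.

Lemma nonadj_trans_switch_isolated (V : finType) (G : sgraph V) y x z :
  nonneg_in_codim 1 (- adjacency_mx G) ->
  let G' := switch G (isolated_vertices G) in
  ~~ adj G' x y -> ~~ adj G' y z -> ~~ adj G' x z.
Proof.
move=> nonnegA G'; rewrite !adj_switch_isolated !negb_or !negbK.
case/andP=> /eqP-> nxy /andP[yz nyz]; rewrite yz /=; apply/negP=> xz.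
have [zU|] := boolP (z \in isolated_vertices G).
  by rewrite adj_sym adj_isolated in xz.
rewrite -(eqP yz) inE => /negP[]; apply/forallP=> w.
by apply: (nonadj_edge_isolated _ nonnegA xz) => //; rewrite adj_sym.
Qed.

Lemma adj_switch_neighbors (V : finType) (G : sgraph V) (v x : V) :
  adj (switch G [set y | adj G v y]) v x = false.
Proof. by rewrite /= /switch_adj !inE adj_irrefl; case: (adj G v x). Qed.

Lemma switching_to_multipartite (V : finType) (G : sgraph V) :
  nonneg_in_codim 1 (seidel_mx G + 1%:M) ->
  exists2 G', switching_equivalent G G' &
    exists c : V -> {set V}, multipartite_coloring G' c.
Proof.
move=> nonnegG; case: (pickP (@predT V)) => [v _|no_vertex]; last first.
  exists (switch G set0); first by exists set0.
  by exists (fun=> set0) => x; have := no_vertex x.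
pose N := [set x | adj G v x]; pose G1 := switch G N.
have swG1 : switching_equivalent G G1 by exists N.
pose U := isolated_vertices G1.
exists (switch G1 U).
  by apply: switching_equivalent_trans swG1 _; exists U.
apply: nonadj_trans_multipartite_coloring => y x z.
apply: nonadj_trans_switch_isolated.
apply: (nonneg_in_codim_adjacency (v := v)); first exact: adj_switch_neighbors.
have specG1 := seidel_spectrum_switching swG1.
exact: nonneg_in_codim_seidel_isospectral specG1 nonnegG.
Qed.

Lemma double_natr_inj (R : numDomainType) :
  injective (fun n : nat => 2 * n%:R : R).
Proof. by move=> m n /eqP; rewrite -!natrM eqr_nat eqn_pmul2l // => /eqP. Qed.

Section CommonColors.

Variables (V W I : finType) (G : sgraph V) (H : sgraph W).
Variables (c : V -> I) (d : W -> I).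

Hypotheses (coloring_c : multipartite_coloring G c)
  (coloring_d : multipartite_coloring H d).

Lemma multipartite_isomorphic :
  perm_eq (part_sizes d) (part_sizes c) -> isomorphic H G.
Proof.
case/perm_eq_map_enum_bij=> s [s' sK s'K] sE.
have [f f_bij fE] :
    exists2 f : W -> V, bijective f & forall y, c (f y) = s (d y).
  apply: perm_eq_map_enum_bij; apply/allP=> i _ /=.
  rewrite !count_map_enum -/(part_size c i) -[i in part_size c i]s'K sE.
  by apply/eqP/eq_card => y; rewrite !inE (can2_eq sK s'K).
by exists f => // x y; rewrite coloring_c coloring_d !fE (can_eq sK).
Qed.

Hypothesis specHG : perm_eq (seidel_spectrum H) (seidel_spectrum G).

Lemma euler_op_part_poly_isospectral :
  euler_op (#|I|%:R - 2) (part_poly c) = euler_op (#|I|%:R - 2) (part_poly d).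
Proof.
apply: (monic_lreg (monicXn _ #|V|)).
transitivity ('X^#|W| * euler_op (#|I|%:R - 2) (part_poly d)); last first.
  by rewrite (card_isospectral specHG).
rewrite -(char_poly_seidel_multipartite coloring_c).
rewrite -(char_poly_seidel_multipartite coloring_d) !char_poly_add_scalar.
by have /perm_spectrum_char_poly-> := specHG.
Qed.

Lemma isospectral_isomorphic_common_colors (m : nat) :
  (0 < m)%N -> (2 < #|[set i | part_size c i == m]|)%N -> isomorphic H G.
Proof.
move=> m_gt0 c_triple; apply: multipartite_isomorphic.
apply: (perm_map_inj (@double_natr_inj algC)); rewrite perm_sym.
apply/prod_XsubC_eq/(prod_XsubC_euler_op_inj (a := 2 * m%:R) _ _ _ _
  euler_op_part_poly_isospectral).
- by rewrite -natrM ltr0n muln_gt0.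
- rewrite count_map (eq_count (a2 := pred1 m)) ?count_map_enum // => n /=.
  exact: (inj_eq (@double_natr_inj algC)).
- by move=> b /mapP[n _ ->]; rewrite -natrM ler0n.
- have /card_gt0P[y _] : (0 < #|W|)%N.
    have /card_gt0P[i] := ltnW (ltnW c_triple).
    rewrite inE => /eqP mE; rewrite -mE in m_gt0.
    by rewrite (card_isospectral specHG) (leq_trans m_gt0) ?max_card.
  exists (2 * (part_size d (d y))%:R); first last.
    by rewrite -natrM ltr0n muln_gt0; apply/card_gt0P; exists y; rewrite inE.
  by apply: (map_f (fun n => 2 * n%:R)); rewrite map_f ?mem_enum.
Qed.

End CommonColors.

Lemma multipartite_coloring_comp (V I J : finType) (f : I -> J)
    (G : sgraph V) (c : V -> I) :
  injective f -> multipartite_coloring G c -> multipartite_coloring G (f \o c).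
Proof. by move=> f_inj cP x y; rewrite cP /= (inj_eq f_inj). Qed.

Lemma card_part_size_comp (V I J : finType) (f : I -> J) (c : V -> I) m :
  injective f ->
  (#|[set i | part_size c i == m]| <=
    #|[set j | part_size (f \o c) j == m]|)%N.
Proof.
move=> f_inj; rewrite -(card_imset _ f_inj); apply/subset_leq_card/subsetP.
move=> _ /imsetP[i + ->]; rewrite !inE => /eqP<-; apply/eqP/eq_card => x.
by rewrite !inE (inj_eq f_inj).
Qed.

Lemma multipartite_isospectral_isomorphic (V W I J : finType)
    (G : sgraph V) (H : sgraph W) (c : V -> I) (d : W -> J) (m : nat) :
  multipartite_coloring G c -> multipartite_coloring H d ->
  perm_eq (seidel_spectrum H) (seidel_spectrum G) ->
  (0 < m)%N -> (2 < #|[set i | part_size c i == m]|)%N -> isomorphic H G.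
Proof.
move=> /(multipartite_coloring_comp (@inl_inj I J)) coloring_c.
move=> /(multipartite_coloring_comp (@inr_inj I J)) coloring_d specHG m_gt0.
move/leq_trans/(_ (card_part_size_comp c m (@inl_inj I J))).
exact: (isospectral_isomorphic_common_colors coloring_c coloring_d).
Qed.

Local Close Scope sesquilinear_scope.
Local Close Scope ring_scope.

Theorem theorem3p7 (l : nat) (p s : 'I_l -> nat)
    (hl : 1 <= l)
    (p_decr : forall i j : 'I_l, i < j -> p j < p i)
    (p_pos : forall i : 'I_l, 1 <= p i)
    (s_ge3 : forall i : 'I_l, 3 <= s i) :
  S_determined (complete_multipartite_rep p s).
Proof.
move=> W H specHG; set G := complete_multipartite_rep p s in specHG *.
have coloring_tag : multipartite_coloring G (fun x => tag x) by [].
have nonnegG := nonneg_in_codim1_multipartite coloring_tag.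
have nonnegH := nonneg_in_codim_seidel_isospectral specHG nonnegG.
have [H' swHH' [d coloring_d]] := switching_to_multipartite nonnegH.
have specH'G := perm_trans (seidel_spectrum_switching swHH') specHG.
exists H' => //; pose i0 := Ordinal hl.
apply: (multipartite_isospectral_isomorphic coloring_tag coloring_d specH'G
  (p_pos i0)).
apply: leq_trans (s_ge3 i0) _; rewrite -[s i0](card_fiber_tag s).
apply/subset_leq_card/subsetP=> k; rewrite !inE => /eqP k_i0.
by rewrite /part_size card_fiber_tag k_i0.
Qed.
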